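(* Let $\Omega$ be a non-empty set and let $\underline{\Gamma}$ be an exact functional whose domain $\operatorname{dom}\underline{\Gamma}$ is a linear lattice of gambles on $\Omega$ that contains all constant gambles. Then $\underline{\Gamma}$ is comonotone additive if and only if it is $2$-monotone, and in both cases, for all $f\in\operatorname{dom}\underline{\Gamma}$, $$\underline{\Gamma}(f)=(C)\int f\,\mathrm{d}\underline{\Gamma}_*=\|\underline{\Gamma}\|\inf f+(R)\int_{\inf f}^{\sup f}\underline{\Gamma}_*(\{f\geq x\})\,\mathrm{d}x,$$ where $\underline{\Gamma}_*$ is the inner extension of $\underline{\Gamma}$ (evaluated at indicators of events), and $(R)\int$ denotes the Riemann integral.
   Context: A gamble on $\Omega$ is a bounded real-valued map on $\Omega$; $\mathcal{L}$ is the set of all gambles, with pointwise operations and order; a real number $\mu$ also denotes the constant gamble $\mu$. An event $A\subseteq\Omega$ is identified with its indicator gamble $I_A$, so that one writes $\underline{\Gamma}_*(A)$ for $\underline{\Gamma}_*(I_A)$; $\{f\ge x\}=\{\omega\in\Omega: f(\omega)\geq x\}$. A functional is a real-valued map defined on a subset of $\mathcal{L}$ (its domain, $\operatorname{dom}$). A functional on $\mathcal{L}$ is exact if for all $f,g\in\mathcal{L}$, real $\lambda\geq0$ and real $\mu$: (E1) $f\geq g$ implies $\underline{\Gamma}(f)\geq\underline{\Gamma}(g)$; (E2) $\underline{\Gamma}(\lambda f)=\lambda\underline{\Gamma}(f)$; (E3) $\underline{\Gamma}(f+g)\geq\underline{\Gamma}(f)+\underline{\Gamma}(g)$; (E4)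 $\underline{\Gamma}(f+\mu)=\underline{\Gamma}(f)+\underline{\Gamma}(\mu)$. A functional on an arbitrary subset of $\mathcal{L}$ is exact if it can be extended to an exact functional on $\mathcal{L}$. Norm: $\|\underline{\Gamma}\|$ is the infimum of all $c\geq0$ such that for all $n\in\{1,2,\dots\}$, $\lambda_1,\dots,\lambda_n\geq0$, $\lambda\in\mathbb{R}$ and $f,f_1,\dots,f_n\in\operatorname{dom}\underline{\Gamma}$: $f\geq\sum_{k=1}^n\lambda_kf_k+\lambda$ implies $\underline{\Gamma}(f)\geq\sum_{k=1}^n\lambda_k\underline{\Gamma}(f_k)+\lambda c$. (Known: if $\underline{\Gamma}$ is exact and $1\in\operatorname{dom}\underline{\Gamma}$, then $\|\underline{\Gamma}\|=\underline{\Gamma}(1)$.) A linear lattice is a linear subspace of $\mathcal{L}$ closed under pointwise minimum $\wedge$ and maximum $\vee$. A functional on a lattice of gambles is $2$-monotone if for $p\in\{1,2\}$ and all $f,f_1,\dots,f_p$ in its domain, $\sum_{I\subseteq\{1,\dots,p\}}(-1)^{|I|}\underline{\Gamma}(f\wedge\bigwedge_{i\in I}f_i)\geq0$ (for $I=\emptyset$ the term $\bigwedge_{i\in I}f_i$ is dropped). Gambles $f,g$ are comonotone if for all $\omega_1,\omega_2\in\Omega$, $f(\omega_1)<f(\omega_2)$ implies $g(\omega_1)\leq g(\omega_2)$. $\underline{\Gamma}$ is comonotone additive if $\underline{\Gamma}(f+g)=\underline{\Gamma}(f)+\underline{\Gamma}(g)$ for all comonotone $f,g$ in its domain. Inner extension: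 $\underline{\Gamma}_*(f)=\sup\{\underline{\Gamma}(g): g\in\operatorname{dom}\underline{\Gamma},\ g\leq f\}$ for all $f\in\mathcal{L}$. Choquet integral: for a monotone real-valued set function $\mu$ on the power set of $\Omega$ with $\mu(\emptyset)=0$, $(C)\int f\,\mathrm{d}\mu=\mu(\Omega)\inf f+(R)\int_{\inf f}^{\sup f}\mu(\{f\geq x\})\,\mathrm{d}x$ for every gamble $f$. *)

(* Defs.v *)
From Stdlib Require Import Reals List ClassicalEpsilon.
From Coquelicot Require Import Coquelicot.

Set Implicit Arguments.
Open Scope R_scope.

Section Gambles.

Variable Omega : Type.

Definition gamble (f : Omega -> R) : Prop :=
  exists M : R, forall w, Rabs (f w) <= M.

Definition gcst (mu : R) : Omega -> R := fun _ => mu.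
Definition gadd (f g : Omega -> R) : Omega -> R := fun w => f w + g w.
Definition gscal (a : R) (f : Omega -> R) : Omega -> R := fun w => a * f w.
Definition gmin (f g : Omega -> R) : Omega -> R := fun w => Rmin (f w) (g w).
Definition gmax (f g : Omega -> R) : Omega -> R := fun w => Rmax (f w) (g w).
Definition gle (f g : Omega -> R) : Prop := forall w, f w <= g w.

(* [Lub_Rbar] and [Glb_Rbar] are extended reals; for a gamble on a non-empty
   set they are finite, so that the projection [real] loses nothing. *)
Definition gsup (f : Omega -> R) : R := real (Lub_Rbar (fun y => exists w, y = f w)).
Definition ginf (f : Omega -> R) : R := real (Glb_Rbar (fun y => exists w, y = f w)).

Definition indicator (A : Omega -> Prop) : Omega -> R :=
  fun w => if excluded_middle_informative (A w) then 1 else 0.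

Definition level_set (f : Omega -> R) (x : R) : Omega -> Prop := fun w => f w >= x.

Definition comonotone (f g : Omega -> R) : Prop :=
  forall w1 w2, f w1 < f w2 -> g w1 <= g w2.

Definition lattice (D : (Omega -> R) -> Prop) : Prop :=
  forall f g, D f -> D g -> D (gmin f g) /\ D (gmax f g).

Definition linear_subspace (D : (Omega -> R) -> Prop) : Prop :=
  D (gcst 0) /\
  (forall f g, D f -> D g -> D (gadd f g)) /\
  (forall a f, D f -> D (gscal a f)).

Definition linear_lattice (D : (Omega -> R) -> Prop) : Prop :=
  linear_subspace D /\ lattice D.

(* A partial real-valued map on gambles; the values of [val] outside [dom] are
   meaningless; the notions below never look at them ([n_monotone] is meant for
   a [dom] that is a lattice). *)
Record functional := Functional {
  dom : (Omega -> R) -> Prop;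
  val :> (Omega -> R) -> R;
  dom_gamble : forall f, dom f -> gamble f
}.

Definition exact_on_all_gambles (G : functional) : Prop :=
  (forall f, gamble f -> dom G f) /\
  (forall f g, gamble f -> gamble g -> gle g f -> G f >= G g) /\
  (forall f lam, gamble f -> 0 <= lam -> G (gscal lam f) = lam * G f) /\
  (forall f g, gamble f -> gamble g -> G (gadd f g) >= G f + G g) /\
  (forall f mu, gamble f -> G (gadd f (gcst mu)) = G f + G (gcst mu)).

Definition extends (E G : functional) : Prop :=
  forall f, dom G f -> dom E f /\ E f = G f.

Definition exact_functional (G : functional) : Prop :=
  exists E : functional, exact_on_all_gambles E /\ extends E G.

Definition norm_bound (G : functional) (c : R) : Prop :=
  0 <= c /\
  forall (n : nat) (lams : nat -> R) (lam : R)
         (f : Omega -> R) (fs : nat -> Omega -> R),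
    (1 <= n)%nat ->
    (forall k, (1 <= k <= n)%nat -> 0 <= lams k /\ dom G (fs k)) ->
    dom G f ->
    (forall w, f w >= sum_n_m (fun k => lams k * fs k w) 1 n + lam) ->
    G f >= sum_n_m (fun k => lams k * G (fs k)) 1 n + lam * c.

(* Infinite when no [c] satisfies [norm_bound]. *)
Definition fnorm (G : functional) : Rbar := Glb_Rbar (norm_bound G).

(* The subfamilies of a finite family [l], one for each set of positions
   (so with repetitions when [l] has repeated entries). *)
Fixpoint subfamilies (T : Type) (l : list T) : list (list T) :=
  match l with
  | nil => nil :: nil
  | x :: l' => subfamilies l' ++ List.map (cons x) (subfamilies l')
  end.

(* [fold_left gmin I f] is the minimum of [f] and all members of [I], and is
   [f] when [I] is empty. *)
Definition n_monotone (n : nat) (G : functional) : Prop :=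
  forall (p : nat) (f : Omega -> R) (fs : list (Omega -> R)),
    (1 <= p <= n)%nat -> List.length fs = p -> dom G f -> List.Forall (dom G) fs ->
    List.fold_right Rplus 0
      (List.map (fun I => (-1) ^ List.length I * G (List.fold_left gmin I f)) (subfamilies fs))
    >= 0.

Definition comonotone_additive (G : functional) : Prop :=
  forall f g, dom G f -> dom G g -> dom G (gadd f g) -> comonotone f g ->
    G (gadd f g) = G f + G g.

(* The supremum is finite when [G] is exact and its domain contains the
   constants. *)
Definition inner (G : functional) (f : Omega -> R) : R :=
  real (Lub_Rbar (fun y => exists g, dom G g /\ gle g f /\ y = G g)).

Definition inner_event (G : functional) (A : Omega -> Prop) : R :=
  inner G (indicator A).

Definition monotone_set_function (mu : (Omega -> Prop) -> R) : Prop :=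
  mu (fun _ => False) = 0 /\
  forall A B : Omega -> Prop, (forall w, A w -> B w) -> mu A <= mu B.

(* Meaningful only for a [monotone_set_function] [mu] and a gamble [f]. *)
Definition choquet (mu : (Omega -> Prop) -> R) (f : Omega -> R) : R :=
  mu (fun _ => True) * ginf f
  + RInt (fun x => mu (level_set f x)) (ginf f) (gsup f).

End Gambles.

(* Main.v *)
Require Import Defs.
From Stdlib Require Import Reals ZArith List Lra Lia FunctionalExtensionality ClassicalEpsilon.
From Coquelicot Require Import Coquelicot.
Open Scope R_scope.

(** The common consequence of both properties is layer additivity,
    [G f = G (f /\ s) + G ((f - s)^+)] for all real [s]: the two layers are
    comonotone, and it is supermodularity of [f] and the constant [s].

    Layer additivity gives the integral: the layer of [f] between [x] and [y] lies
    between the indicators of [{f >= y}] and [{f >= x}], scaled by [y - x], so that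
    [F x = G (f /\ x)] satisfies [(y - x) m(y) <= F y - F x <= (y - x) m(x)] with
    [m(x) = G_*({f >= x})] nonincreasing, and any Riemann sum of [m] over
    [inf f, sup f] is close to [F (sup f) - F (inf f) = G f - G(1) inf f].

    For the implication to 2-monotonicity, [a] and [b] are cut into layers of width
    [eps]; each layer of [a \/ b] is comonotone with the next layer of [a /\ b].
    For the converse, the inner extension inherits supermodularity, hence layer
    additivity, on all gambles; there comonotone [f] and [g] may be rounded down to
    multiples of [eps], and the bottom layers stripped off one by one. *)

(** * Riemann sums of nonincreasing functions *)

(** On a cell from [x] to [x'] with tag [t], both [(x' - x) * m t] and [F x' - F x] lie between
    [(x' - x) * m x'] and [(x' - x) * m x], so they differ by at most [delta * (m x - m x')]. These
    errors telescope along the subdivision. *)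
Lemma antitone_Riemann_sum (m F : R -> R) (delta : R) :
  (forall x y, x <= y -> m y <= m x) ->
  (forall x y, x <= y -> (y - x) * m y <= F y - F x <= (y - x) * m x) ->
  forall ptd, pointed_subdiv ptd -> seq_step (SF_lx ptd) <= delta ->
  SF_h ptd <= seq.last (SF_h ptd) (SF_lx ptd) /\
  Rabs (Riemann_sum m ptd - (F (seq.last (SF_h ptd) (SF_lx ptd)) - F (SF_h ptd)))
    <= delta * (m (SF_h ptd) - m (seq.last (SF_h ptd) (SF_lx ptd))).
Proof.
intros Hm HF ptd; induction ptd as [x0 | [x t] s IH] using SF_cons_ind.
- intros _ _; cbn.
  split; [lra|].
  replace (_ - _) with 0 by (unfold zero; simpl; lra).
  rewrite Rabs_R0; lra.
- intros Hp Hs.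
  assert (H0 := Hp O ltac:(cbn; lia)); cbn in H0.
  assert (Hs' : Rabs (SF_h s - x) <= delta /\ seq_step (SF_lx s) <= delta).
  { split; eapply Rle_trans; try exact Hs;
      rewrite SF_lx_cons; [apply Rmax_l | apply Rmax_r]. }
  destruct Hs' as [Hx Hs'].
  destruct (IH (ptd_cons _ _ Hp) Hs') as [Hle Hab]; clear IH.
  rewrite Riemann_sum_cons.
  replace (seq.last (SF_h (SF_cons (x, t) s)) (SF_lx (SF_cons (x, t) s)))
    with (seq.last (SF_h s) (SF_lx s)) by reflexivity.
  change (SF_h (SF_cons (x, t) s)) with x.
  change (plus (scal (SF_h s - fst (x, t)) (m (snd (x, t)))) (Riemann_sum m s))
    with ((SF_h s - x) * m t + Riemann_sum m s).
  assert (Hxt : x <= t <= SF_h s) by (destruct s; exact H0).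
  assert (HFx := HF x (SF_h s) ltac:(lra)).
  assert (m (SF_h s) <= m t) by (apply Hm; lra).
  assert (m t <= m x) by (apply Hm; lra).
  rewrite Rabs_right in Hx by lra.
  split; [lra|].
  apply Rabs_le_between in Hab.
  apply Rabs_le_between.
  assert ((SF_h s - x) * m t <= (SF_h s - x) * m x) by (apply Rmult_le_compat_l; lra).
  assert ((SF_h s - x) * m (SF_h s) <= (SF_h s - x) * m t)
    by (apply Rmult_le_compat_l; lra).
  assert ((SF_h s - x) * (m x - m (SF_h s)) <= delta * (m x - m (SF_h s)))
    by (apply Rmult_le_compat_r; lra).
  lra.
Qed.

Lemma antitone_is_RInt (m F : R -> R) (a b : R) :
  a <= b ->
  (forall x y, x <= y -> m y <= m x) ->
  (forall x y, x <= y -> (y - x) * m y <= F y - F x <= (y - x) * m x) ->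
  is_RInt m a b (F b - F a).
Proof.
intros Hab Hm HF.
(* The definition of [is_RInt] multiplies the Riemann sum by [sign (b - a)], which is 1 only for
   [a < b]; hence the separate case. *)
destruct (Req_dec a b) as [->|Hne].
{ replace (F b - F b) with (@zero R_NormedModule) by (unfold zero; simpl; lra).
  apply is_RInt_point. }
assert (Hmab := Hm a b Hab).
apply filterlim_locally; intros eps.
(* The summand 1 keeps the denominator positive when [m a = m b] and makes the final estimate
   strict. *)
assert (Hd : 0 < eps / (m a - m b + 1)) by (apply Rdiv_lt_0_compat; [apply cond_pos | lra]).
exists (mkposreal _ Hd); intros ptd Hstep [Hp [Hh Hl]].
destruct (antitone_Riemann_sum m F _ Hm HF ptd Hp (Rlt_le _ _ Hstep)) as [_ Hr].
rewrite Hl, Hh, Rmin_left, Rmax_right in Hr by lra.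
replace (sign (b - a)) with 1 by (symmetry; apply sign_eq_1; lra).
change (Rabs (1 * Riemann_sum m ptd - (F b - F a)) < eps).
rewrite Rmult_1_l.
eapply Rle_lt_trans; [exact Hr|]; cbn.
apply Rlt_le_trans with (eps / (m a - m b + 1) * (m a - m b + 1)).
- apply Rmult_lt_compat_l; lra.
- right; field; lra.
Qed.

(** * Lower functionals and layers of gambles *)

Section Layers.

Context {Omega : Type}.
Implicit Types f g h : Omega -> R.

(* Positive homogeneity is left out, so that the inner extension need not be
   shown to have it. *)
Record lower_functional (D : (Omega -> R) -> Prop) (V : (Omega -> R) -> R) : Prop := {
  lf_gamble : forall f, D f -> gamble f;
  lf_add : forall f g, D f -> D g -> D (gadd f g);
  lf_min : forall f g, D f -> D g -> D (gmin f g);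
  lf_max : forall f g, D f -> D g -> D (gmax f g);
  lf_cst : forall mu, D (gcst mu);
  lf_mono : forall f g, D f -> D g -> gle f g -> V f <= V g;
  lf_superadd : forall f g, D f -> D g -> V f + V g <= V (gadd f g);
  lf_shift : forall f mu, D f -> V (gadd f (gcst mu)) = V f + mu * V (gcst 1);
  lf_val_cst : forall mu, V (gcst mu) = mu * V (gcst 1)
}.

(** The positive part $(f-s)^+$, that is, the part of [f] above level [s]; the part below is
    [gmin f (gcst s)]. *)
Definition excess f (s : R) : Omega -> R := gmax (gadd f (gcst (- s))) (gcst 0).

Definition supermodular (D : (Omega -> R) -> Prop) (V : (Omega -> R) -> R) : Prop :=
  forall f g, D f -> D g -> V f + V g <= V (gmax f g) + V (gmin f g).

Definition layer_additive (D : (Omega -> R) -> Prop) (V : (Omega -> R) -> R) : Prop :=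
  forall f s, D f -> V f = V (gmin f (gcst s)) + V (excess f s).

End Layers.

Arguments lf_gamble {Omega D V}.
Arguments lf_add {Omega D V}.
Arguments lf_min {Omega D V}.
Arguments lf_max {Omega D V}.
Arguments lf_cst {Omega D V}.
Arguments lf_mono {Omega D V}.
Arguments lf_superadd {Omega D V}.
Arguments lf_shift {Omega D V}.
Arguments lf_val_cst {Omega D V}.

(** A comparison is split only when its operands contain no further comparison, so that the new
    hypotheses are within reach of [lra], which discards impossible cases at once. *)
Ltac split_innermost x y :=
  lazymatch constr:((x, y)) with
  | context [Rle_dec _ _] => fail
  | _ => destruct (Rle_dec x y); try (exfalso; lra)
  end.

Ltac pointwise :=
  unfold gle, excess, gadd, gscal, gmin, gmax, gcst, Rmin, Rmax in *; intros;
  repeat match goal with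
  | |- context [Rle_dec ?x ?y] => split_innermost x y
  | _ : context [Rle_dec ?x ?y] |- _ => split_innermost x y
  end; lra.

Ltac gamble_ext := apply functional_extensionality; intro; pointwise.

Lemma le_of_le_add_small (x y k : R) :
  (forall e, 0 < e -> x <= y + e * k) -> x <= y.
Proof.
intros H; apply Rnot_lt_le; intros Hyx.
assert (Hk := Rabs_pos k); assert (Hk' := RRle_abs k).
(* With this choice [e * k] is at most half of the gap [x - y]; the absolute value allows [k] of any
   sign. *)
set (e := (x - y) / (2 * (Rabs k + 1))).
assert (He : 0 < e) by (apply Rdiv_lt_0_compat; lra).
specialize (H e He).
assert (e * k <= e * (Rabs k + 1)) by (apply Rmult_le_compat_l; lra).
assert (e * (Rabs k + 1) = (x - y) / 2) by (unfold e; field; lra).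
lra.
Qed.

Lemma exists_INR_mult_ge (M eps : R) : 0 < eps -> exists n, M <= INR n * eps.
Proof.
intros Heps.
destruct (INR_archimed eps M Heps) as [n Hn].
exists n; lra.
Qed.

(** * From comonotone additivity to supermodularity *)

Section LowerFunctional.

Context {Omega : Type} {D : (Omega -> R) -> Prop} {V : (Omega -> R) -> R}.
Hypothesis HV : lower_functional D V.

Lemma excess_dom f s : D f -> D (excess f s).
Proof.
intro Hf; unfold excess.
now apply (lf_max HV); [apply (lf_add HV); [|apply (lf_cst HV)]|apply (lf_cst HV)].
Qed.

Local Ltac in_dom :=
  repeat match goal with
  | |- D (gcst _) => apply (lf_cst HV)
  | |- D (gadd _ _) => apply (lf_add HV)
  | |- D (gmin _ _) => apply (lf_min HV)
  | |- D (gmax _ _) => apply (lf_max HV)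
  | |- D (excess _ _) => apply excess_dom
  | |- D _ => assumption
  end.

Lemma val_cst0 : V (gcst 0) = 0.
Proof. rewrite (lf_val_cst HV); ring. Qed.

Lemma cst1_ge0 : 0 <= V (gcst 1).
Proof.
rewrite <- val_cst0; apply (lf_mono HV); in_dom.
pointwise.
Qed.

Lemma min_add_excess (f : Omega -> R) s : gadd (gmin f (gcst s)) (excess f s) = f.
Proof. gamble_ext. Qed.

(** Since $f \vee s = (f-s)^+ + s$, supermodularity of [f] and the constant [s] gives one
    inequality; superadditivity gives the other. *)
Lemma supermodular_layer_additive : supermodular D V -> layer_additive D V.
Proof.
intros H f s Hf.
apply Rle_antisym.
- assert (Hs := H f (gcst s) Hf (lf_cst HV s)).
  replace (gmax f (gcst s)) with (gadd (excess f s) (gcst s)) in Hs by gamble_ext.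
  rewrite (lf_shift HV), (lf_val_cst HV s) in Hs by in_dom.
  lra.
- rewrite <- (min_add_excess f s) at 3.
  apply (lf_superadd HV); in_dom.
Qed.

(** Both layers are nondecreasing functions of [f], hence comonotone, and they add up to [f]. *)
Lemma comonotone_layer_additive :
  (forall f g, D f -> D g -> comonotone f g -> V (gadd f g) = V f + V g) ->
  layer_additive D V.
Proof.
intros H f s Hf.
rewrite <- H; in_dom.
- now rewrite min_add_excess.
- intros w1 w2; pointwise.
Qed.

(* In the inductive step the bottom layer of [a \/ b] and the second layer of
   [a /\ b] are comonotone: the former is maximal wherever the latter is
   non-zero. Their sum dominates the sum of the second layers of [a] and [b]. *)
Lemma comonotone_supermodular_excess eps n a b :
  (forall f g, D f -> D g -> comonotone f g -> V (gadd f g) = V f + V g) ->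
  0 < eps -> D a -> D b ->
  (forall w, 0 <= a w <= INR n * eps) -> (forall w, 0 <= b w <= INR n * eps) ->
  V (excess a eps) + V (excess b eps)
    <= V (gmax a b) + V (gmin (excess a eps) (excess b eps)).
Proof.
intros H Heps; assert (HL := comonotone_layer_additive H).
revert a b; induction n as [|n IH]; intros a b Da Db Ha Hb.
- cbn in Ha, Hb.
  assert (Ea : a = gcst 0)
    by (apply functional_extensionality; intro w; specialize (Ha w); pointwise).
  assert (Eb : b = gcst 0)
    by (apply functional_extensionality; intro w; specialize (Hb w); pointwise).
  subst a b.
  replace (gmax (gcst 0) (gcst 0)) with (@gcst Omega 0) by gamble_ext.
  replace (excess (gcst 0) eps) with (@gcst Omega 0) by gamble_ext.
  replace (gmin (gcst 0) (gcst 0)) with (@gcst Omega 0) by gamble_ext.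
  lra.
- rewrite S_INR in Ha, Hb.
  assert (Hn : 0 <= INR n * eps) by (apply Rmult_le_pos; [apply pos_INR | lra]).
  assert (HI := IH (excess a eps) (excess b eps) ltac:(in_dom) ltac:(in_dom)).
  lapply HI; clear HI; [intro HI|intro w; specialize (Ha w); pointwise].
  lapply HI; clear HI; [intro HI|intro w; specialize (Hb w); pointwise].
  (* All four terms are cut at [eps]: the upper parts satisfy the induction hypothesis, and only the
     bottom layers remain to be compared. *)
  rewrite (HL (gmax a b) eps), (HL (gmin (excess a eps) (excess b eps)) eps),
    (HL (excess a eps) eps), (HL (excess b eps) eps) by in_dom.
  replace (excess (gmax a b) eps) with (gmax (excess a eps) (excess b eps)) by gamble_ext.
  replace (excess (gmin (excess a eps) (excess b eps)) eps)
    with (gmin (excess (excess a eps) eps) (excess (excess b eps) eps)) by gamble_ext.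
  set (p := gmin (gmax a b) (gcst eps)).
  set (q := gmin (gmin (excess a eps) (excess b eps)) (gcst eps)).
  assert (Hpq : V (gadd p q) = V p + V q).
  { apply H; unfold p, q; in_dom.
    intros w1 w2; pointwise. }
  (* Pointwise, the smaller of the two truncated excesses is [q] and the larger one is at most
     [p]. *)
  assert (Hsum : V (gadd (gmin (excess a eps) (gcst eps)) (gmin (excess b eps) (gcst eps)))
                 <= V (gadd p q)).
  { apply (lf_mono HV); unfold p, q; in_dom.
    intro w; specialize (Ha w); specialize (Hb w); pointwise. }
  assert (Hsup := lf_superadd HV (gmin (excess a eps) (gcst eps))
                    (gmin (excess b eps) (gcst eps)) ltac:(in_dom) ltac:(in_dom)).
  lra.
Qed.

(** A shift by [K] makes both gambles nonnegative. The preceding inequality then holds for every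
    width; going back from the excesses to [a] and [b] costs at most one width times [V (gcst 1)]
    for each, and the width tends to 0. *)
Lemma comonotone_supermodular :
  (forall f g, D f -> D g -> comonotone f g -> V (gadd f g) = V f + V g) ->
  supermodular D V.
Proof.
intros H f g Df Dg.
destruct (lf_gamble HV f Df) as [M HM], (lf_gamble HV g Dg) as [N HN].
set (K := Rmax M N).
assert (HfK : forall w, 0 <= f w + K <= 2 * K).
{ intro w; specialize (HM w); apply Rabs_le_between in HM.
  assert (M <= K) by apply Rmax_l; lra. }
assert (HgK : forall w, 0 <= g w + K <= 2 * K).
{ intro w; specialize (HN w); apply Rabs_le_between in HN.
  assert (N <= K) by apply Rmax_r; lra. }
set (a := gadd f (gcst K)); set (b := gadd g (gcst K)).
assert (Da : D a) by (unfold a; in_dom); assert (Db : D b) by (unfold b; in_dom).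
assert (Hab : V a + V b <= V (gmax a b) + V (gmin a b)).
{ apply le_of_le_add_small with (k := 2 * V (gcst 1)); intros e He.
  destruct (exists_INR_mult_ge (2 * K) e He) as [n Hn].
  assert (Hex := comonotone_supermodular_excess e n a b H He Da Db).
  lapply Hex; clear Hex;
    [intro Hex | intro w; specialize (HfK w); unfold a, gadd, gcst; lra].
  lapply Hex; clear Hex;
    [intro Hex | intro w; specialize (HgK w); unfold b, gadd, gcst; lra].
  assert (V a <= V (excess a e) + e * V (gcst 1)).
  { rewrite <- (lf_shift HV) by in_dom.
    apply (lf_mono HV); in_dom; pointwise. }
  assert (V b <= V (excess b e) + e * V (gcst 1)).
  { rewrite <- (lf_shift HV) by in_dom.
    apply (lf_mono HV); in_dom; pointwise. }
  assert (V (gmin (excess a e) (excess b e)) <= V (gmin a b)).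
  { apply (lf_mono HV); in_dom.
    intro w; specialize (HfK w); specialize (HgK w).
    unfold a, b; pointwise. }
  lra. }
replace (gmax a b) with (gadd (gmax f g) (gcst K)) in Hab by (unfold a, b; gamble_ext).
replace (gmin a b) with (gadd (gmin f g) (gcst K)) in Hab by (unfold a, b; gamble_ext).
unfold a, b in Hab.
rewrite !(lf_shift HV) in Hab by in_dom.
lra.
Qed.

End LowerFunctional.

(** * From layer additivity to comonotone additivity on all gambles *)

Section AllGambles.

Context {Omega : Type} {V : (Omega -> R) -> R}.
Hypothesis HV : lower_functional (@gamble Omega) V.
Hypothesis HL : layer_additive (@gamble Omega) V.

(** The multipliers are natural numbers, so that for positive [eps] such a gamble is nonnegative and
    vanishes after finitely many layers are removed. *)
Definition multiple_of (eps : R) (f : Omega -> R) : Prop :=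
  forall w, exists k : nat, f w = INR k * eps.

Lemma multiple_of_cases eps f w :
  0 < eps -> multiple_of eps f -> f w = 0 \/ eps <= f w.
Proof.
intros Heps Hf; destruct (Hf w) as [[|k] ->]; [left; simpl; ring | right].
rewrite S_INR.
assert (0 <= INR k * eps) by (apply Rmult_le_pos; [apply pos_INR | lra]).
lra.
Qed.

Lemma multiple_of_excess eps f :
  0 < eps -> multiple_of eps f -> multiple_of eps (excess f eps).
Proof.
intros Heps Hf w; destruct (Hf w) as [[|k] Hk].
- exists O; simpl in *; pointwise.
- exists k; rewrite S_INR in Hk.
  assert (0 <= INR k * eps) by (apply Rmult_le_pos; [apply pos_INR | lra]).
  pointwise.
Qed.

Lemma comonotone_sym (f g : Omega -> R) : comonotone f g -> comonotone g f.
Proof.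
intros H w1 w2 Hg; apply Rnot_lt_le; intro Hf.
specialize (H w2 w1 Hf); lra.
Qed.

(* If [g] vanishes wherever [f] does, then [f] and [f + g] have the same bottom
   layer, so that this layer can be removed from both. *)
Lemma strip_bottom_layer eps f g :
  0 < eps -> gamble f -> gamble g -> multiple_of eps f -> multiple_of eps g ->
  (forall w, 0 < g w -> 0 < f w) ->
  V (gadd (excess f eps) g) <= V (excess f eps) + V g ->
  V (gadd f g) <= V f + V g.
Proof.
intros Heps Hf Hg Mf Mg Hfg HI.
rewrite (HL (gadd f g) eps (lf_add HV _ _ Hf Hg)), (HL f eps Hf).
assert (Hcase : forall w, f w = 0 /\ g w = 0 \/ eps <= f w /\ 0 <= g w).
{ intro w; specialize (Hfg w).
  destruct (multiple_of_cases eps f w Heps Mf);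
    destruct (multiple_of_cases eps g w Heps Mg); lra. }
replace (gmin (gadd f g) (gcst eps)) with (gmin f (gcst eps))
  by (apply functional_extensionality; intro w; destruct (Hcase w); pointwise).
replace (excess (gadd f g) eps) with (gadd (excess f eps) g)
  by (apply functional_extensionality; intro w; destruct (Hcase w); pointwise).
lra.
Qed.

(** Induction on the height of [f + g] in units of [eps]: each step strips a bottom layer from the
    gamble that is positive wherever the other one is. Comonotonicity ensures that one of the two
    has this property. *)
Lemma comonotone_multiples_subadd eps n f g :
  0 < eps -> gamble f -> gamble g -> multiple_of eps f -> multiple_of eps g ->
  comonotone f g -> (forall w, f w + g w <= INR n * eps) ->
  V (gadd f g) <= V f + V g.
Proof.
intros Heps; revert f g; induction n as [|n IH]; intros f g Hf Hg Mf Mg Hc Hn.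
- assert (E : forall w, f w = 0 /\ g w = 0).
  { intro w; specialize (Hn w); simpl in Hn.
    destruct (multiple_of_cases eps f w Heps Mf);
      destruct (multiple_of_cases eps g w Heps Mg); lra. }
  replace f with (@gcst Omega 0)
    by (apply functional_extensionality; intro w; destruct (E w); pointwise).
  replace g with (@gcst Omega 0)
    by (apply functional_extensionality; intro w; destruct (E w); pointwise).
  replace (gadd (gcst 0) (gcst 0)) with (@gcst Omega 0) by gamble_ext.
  rewrite (val_cst0 HV); lra.
- rewrite S_INR in Hn.
  assert (Hstep : forall f g, gamble f -> gamble g -> multiple_of eps f ->
            multiple_of eps g -> comonotone f g ->
            (forall w, f w + g w <= (INR n + 1) * eps) ->
            (forall w, 0 < g w -> 0 < f w) -> V (gadd f g) <= V f + V g).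
  { clear f g Hf Hg Mf Mg Hc Hn; intros f g Hf Hg Mf Mg Hc Hn Hfg.
    apply (strip_bottom_layer eps); auto.
    apply IH; auto.
    - now apply (excess_dom HV).
    - now apply multiple_of_excess.
    - intros w1 w2 Hlt; apply Hc; pointwise.
    (* Where [f] vanishes, so does [g]; elsewhere [f] is at least [eps], and the sum drops by
       exactly [eps]. *)
    - intro w; specialize (Hn w); specialize (Hfg w).
      assert (0 <= INR n * eps) by (apply Rmult_le_pos; [apply pos_INR | lra]).
      destruct (multiple_of_cases eps f w Heps Mf);
        destruct (multiple_of_cases eps g w Heps Mg); pointwise. }
  (* If [g] is positive at some [w0] where [f] is not, then [g w >= g w0 > 0] wherever [f w > 0],
     and the two gambles exchange roles. *)
  destruct (classic (forall w, 0 < g w -> 0 < f w)) as [Hfg|Hfg]; [now apply Hstep|].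
  apply not_all_ex_not in Hfg as [w0 Hw0].
  apply imply_to_and in Hw0 as [Hg0 Hf0].
  replace (gadd f g) with (gadd g f) by gamble_ext.
  rewrite Rplus_comm.
  apply Hstep; auto.
  + now apply comonotone_sym.
  + intro w; rewrite Rplus_comm; apply Hn.
  + intros w Hfw.
    assert (g w0 <= g w) by (apply Hc; lra).
    lra.
Qed.

Definition discretize (eps : R) (f : Omega -> R) : Omega -> R :=
  fun w => IZR (Int_part (f w / eps)) * eps.

Lemma discretize_bounds eps f w :
  0 < eps -> discretize eps f w <= f w <= discretize eps f w + eps.
Proof.
intros Heps; unfold discretize.
destruct (base_Int_part (f w / eps)) as [H1 H2].
assert (E : f w = f w / eps * eps) by (field; lra).
set (k := IZR (Int_part (f w / eps))) in *.
assert (k * eps <= f w / eps * eps) by (apply Rmult_le_compat_r; lra).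
assert (f w / eps * eps <= (k + 1) * eps) by (apply Rmult_le_compat_r; lra).
lra.
Qed.

Lemma discretize_multiple_of eps f :
  0 < eps -> (forall w, 0 <= f w) -> multiple_of eps (discretize eps f).
Proof.
intros Heps Hf w; exists (Z.to_nat (Int_part (f w / eps))).
unfold discretize; rewrite INR_IZR_INZ, Z2Nat.id; auto.
destruct (base_Int_part (f w / eps)) as [_ H].
assert (0 <= f w / eps) by (apply Rdiv_le_0_compat; auto).
apply Z.lt_succ_r, lt_IZR; rewrite succ_IZR; lra.
Qed.

Lemma Int_part_mono x y : x <= y -> (Int_part x <= Int_part y)%Z.
Proof.
intros Hxy.
destruct (base_Int_part x), (base_Int_part y).
apply Z.lt_succ_r, lt_IZR; rewrite succ_IZR; lra.
Qed.

Lemma discretize_lt_reg eps f w1 w2 :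
  0 < eps -> discretize eps f w1 < discretize eps f w2 -> f w1 < f w2.
Proof.
intros Heps H; apply Rnot_le_lt; intro Hle.
apply (Rlt_not_le _ _ H), Rmult_le_compat_r; [lra|].
apply IZR_le, Int_part_mono, Rmult_le_compat_r; auto.
left; now apply Rinv_0_lt_compat.
Qed.

(** Rounding down is nondecreasing, so a strict inequality between rounded values comes from one
    between the original values. *)
Lemma discretize_comonotone eps f g :
  0 < eps -> comonotone f g -> comonotone (discretize eps f) (discretize eps g).
Proof.
intros Heps H w1 w2 Hlt.
apply Rnot_lt_le; intro Hlt'.
apply discretize_lt_reg in Hlt; auto; apply discretize_lt_reg in Hlt'; auto.
specialize (H w1 w2 Hlt); lra.
Qed.

Lemma gamble_between (f l u : Omega -> R) : gle l f -> gle f u -> gamble l -> gamble u -> gamble f.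
Proof.
intros Hl Hu [M HM] [N HN]; exists (Rmax M N); intro w.
specialize (Hl w); specialize (Hu w); specialize (HM w); specialize (HN w).
apply Rabs_le_between in HM, HN; apply Rabs_le_between.
assert (HMm := Rmax_l M N); assert (HNm := Rmax_r M N); lra.
Qed.

Lemma discretize_gamble eps f : 0 < eps -> gamble f -> gamble (discretize eps f).
Proof.
intros Heps Hf.
apply gamble_between with (l := gadd f (gcst (- eps))) (u := f); auto.
- intro w; assert (H := discretize_bounds eps f w Heps); pointwise.
- intro w; apply discretize_bounds; auto.
- apply (lf_add HV), (lf_cst HV); auto.
Qed.

(** Rounding lowers each gamble by at most [e], so the inequality for the rounded gambles carries
    over up to [2 * e * V (gcst 1)], and [e] tends to 0. *)
Lemma comonotone_subadd_nonneg f g :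
  gamble f -> gamble g -> (forall w, 0 <= f w) -> (forall w, 0 <= g w) ->
  comonotone f g -> V (gadd f g) <= V f + V g.
Proof.
intros Hf Hg Pf Pg Hc.
apply le_of_le_add_small with (k := 2 * V (gcst 1)); intros e He.
assert (Hdf := discretize_gamble e f He Hf).
assert (Hdg := discretize_gamble e g He Hg).
set (df := discretize e f) in *; set (dg := discretize e g) in *.
assert (Bf : forall w, df w <= f w <= df w + e) by (intro; now apply discretize_bounds).
assert (Bg : forall w, dg w <= g w <= dg w + e) by (intro; now apply discretize_bounds).
assert (Hd : V (gadd df dg) <= V df + V dg).
{ destruct (lf_add HV _ _ Hdf Hdg) as [M HM].
  destruct (exists_INR_mult_ge M e He) as [n Hn].
  apply (comonotone_multiples_subadd e n); auto.
  - now apply discretize_multiple_of.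
  - now apply discretize_multiple_of.
  - now apply discretize_comonotone.
  - intro w; specialize (HM w); apply Rabs_le_between in HM; unfold gadd in HM; lra. }
assert (V df <= V f) by (apply (lf_mono HV); auto; intro w; apply Bf).
assert (V dg <= V g) by (apply (lf_mono HV); auto; intro w; apply Bg).
assert (V (gadd f g) <= V (gadd (gadd df dg) (gcst (2 * e)))).
{ apply (lf_mono HV).
  - now apply (lf_add HV).
  - apply (lf_add HV); [now apply (lf_add HV) | apply (lf_cst HV)].
  - intro w; specialize (Bf w); specialize (Bg w); pointwise. }
rewrite (lf_shift HV) in * by now apply (lf_add HV).
lra.
Qed.

Lemma comonotone_subadd f g :
  gamble f -> gamble g -> comonotone f g -> V (gadd f g) <= V f + V g.
Proof.
intros Hf Hg Hc.
destruct (Hf) as [M HM], (Hg) as [N HN].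
assert (H : V (gadd (gadd f (gcst M)) (gadd g (gcst N)))
            <= V (gadd f (gcst M)) + V (gadd g (gcst N))).
{ apply comonotone_subadd_nonneg.
  - apply (lf_add HV), (lf_cst HV); auto.
  - apply (lf_add HV), (lf_cst HV); auto.
  - intro w; specialize (HM w); apply Rabs_le_between in HM; pointwise.
  - intro w; specialize (HN w); apply Rabs_le_between in HN; pointwise.
  - intros w1 w2 Hlt; specialize (Hc w1 w2); pointwise. }
replace (gadd (gadd f (gcst M)) (gadd g (gcst N)))
  with (gadd (gadd f g) (gcst (M + N))) in H by gamble_ext.
rewrite !(lf_shift HV) in H by (auto; now apply (lf_add HV)).
lra.
Qed.

End AllGambles.

(** * The inner extension and the equivalence of the two properties *)

Section Inner.

Context {Omega : Type}.
Variable G : functional Omega.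
Hypothesis HG : lower_functional (dom G) G.

(** If $|f| \le M$, the constant $-M$ is an admissible minorant and [G (gcst M)] bounds all values,
    so the supremum is finite. *)
Lemma inner_lub f : gamble f ->
  is_lub_Rbar (fun y => exists g, dom G g /\ gle g f /\ y = G g) (inner G f).
Proof.
intros [M HM].
assert (Hf : forall w, - M <= f w <= M) by (intro w; now apply Rabs_le_between).
unfold inner; set (S := fun y => _); assert (HS := Lub_Rbar_correct S).
assert (Hub : is_ub_Rbar S (G (gcst M))).
{ intros y (g & Dg & Hgf & ->).
  apply (lf_mono HG); auto; [apply (lf_cst HG)|].
  intro w; specialize (Hf w); specialize (Hgf w); pointwise. }
assert (Hne : S (G (gcst (- M)))).
{ exists (gcst (- M)); repeat split; [apply (lf_cst HG)|].
  intro w; specialize (Hf w); pointwise. }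
destruct HS as [H1 H2].
assert (Hl := H1 _ Hne); assert (Hu := H2 _ Hub).
now destruct (Lub_Rbar S).
Qed.

Lemma inner_ge f g : gamble f -> dom G g -> gle g f -> G g <= inner G f.
Proof.
intros Hf Dg Hgf; apply (proj1 (inner_lub f Hf)); eauto.
Qed.

Lemma inner_le f b :
  gamble f -> (forall g, dom G g -> gle g f -> G g <= b) -> inner G f <= b.
Proof.
intros Hf H; apply (proj2 (inner_lub f Hf) (Finite b)).
intros y (g & Dg & Hgf & ->); simpl; auto.
Qed.

Lemma inner_extends f : dom G f -> inner G f = G f.
Proof.
intros Df; assert (Hf := lf_gamble HG f Df).
apply Rle_antisym.
- apply inner_le; auto; intros g Dg Hgf; now apply (lf_mono HG).
- apply inner_ge; auto; intro w; lra.
Qed.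

Lemma gamble_add (f g : Omega -> R) : gamble f -> gamble g -> gamble (gadd f g).
Proof.
intros [M HM] [N HN]; exists (M + N); intro w.
specialize (HM w); specialize (HN w).
eapply Rle_trans; [apply Rabs_triang | lra].
Qed.

Lemma gamble_min (f g : Omega -> R) : gamble f -> gamble g -> gamble (gmin f g).
Proof.
intros [M HM] [N HN]; exists (Rmax M N); intro w; unfold gmin.
assert (HMm := Rmax_l M N); assert (HNm := Rmax_r M N).
specialize (HM w); specialize (HN w).
unfold Rmin; destruct Rle_dec; lra.
Qed.

Lemma gamble_max (f g : Omega -> R) : gamble f -> gamble g -> gamble (gmax f g).
Proof.
intros [M HM] [N HN]; exists (Rmax M N); intro w; unfold gmax at 1.
assert (HMm := Rmax_l M N); assert (HNm := Rmax_r M N).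
specialize (HM w); specialize (HN w).
unfold Rmax at 1; destruct Rle_dec; lra.
Qed.

Lemma gamble_cst mu : gamble (@gcst Omega mu).
Proof. exists (Rabs mu); intro w; unfold gcst; lra. Qed.

Lemma inner_superadd f g :
  gamble f -> gamble g -> inner G f + inner G g <= inner G (gadd f g).
Proof.
intros Hf Hg.
(* The other terms are moved to the right, so that the two suprema can be treated one at a time. *)
enough (inner G f <= inner G (gadd f g) - inner G g) by lra.
apply inner_le; auto; intros h Dh Hh.
enough (inner G g <= inner G (gadd f g) - G h) by lra.
apply inner_le; auto; intros k Dk Hk.
enough (G h + G k <= inner G (gadd f g)) by lra.
eapply Rle_trans; [now apply (lf_superadd HG)|].
apply inner_ge.
- now apply gamble_add.
- now apply (lf_add HG).
- intro w; specialize (Hh w); specialize (Hk w); pointwise.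
Qed.

Lemma inner_cst mu : inner G (gcst mu) = mu * G (gcst 1).
Proof. rewrite inner_extends by apply (lf_cst HG); apply (lf_val_cst HG). Qed.

Lemma inner_lower_functional : lower_functional (@gamble Omega) (inner G).
Proof.
constructor; auto using gamble_add, gamble_min, gamble_max, gamble_cst, inner_superadd.
- intros f g Hf Hg Hfg; apply inner_le; auto; intros h Dh Hh.
  apply inner_ge; auto; intro w; specialize (Hfg w); specialize (Hh w); lra.
- intros f mu Hf; rewrite inner_cst.
  (* Superadditivity for adding [mu] and then for adding [- mu] back gives the two inequalities of
     the shift rule. *)
  assert (H1 := inner_superadd f (gcst mu) Hf (gamble_cst mu)).
  assert (H2 := inner_superadd (gadd f (gcst mu)) (gcst (- mu))
                  (gamble_add _ _ Hf (gamble_cst mu)) (gamble_cst (- mu))).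
  replace (gadd (gadd f (gcst mu)) (gcst (- mu))) with f in H2 by gamble_ext.
  rewrite inner_cst in H1, H2; lra.
- intros mu; rewrite !inner_cst; ring.
Qed.

(** If $h \le f$ and $k \le g$, then $h \vee k \le f \vee g$ and $h \wedge k \le f \wedge g$;
    suprema over [h] and [k] follow. *)
Lemma inner_supermodular : supermodular (dom G) G -> supermodular (@gamble Omega) (inner G).
Proof.
intros H f g Hf Hg.
enough (inner G f <= inner G (gmax f g) + inner G (gmin f g) - inner G g) by lra.
apply inner_le; auto; intros h Dh Hh.
enough (inner G g <= inner G (gmax f g) + inner G (gmin f g) - G h) by lra.
apply inner_le; auto; intros k Dk Hk.
assert (Hhk := H h k Dh Dk).
assert (G (gmax h k) <= inner G (gmax f g)).
{ apply inner_ge; [now apply gamble_max | now apply (lf_max HG) |].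
  intro w; specialize (Hh w); specialize (Hk w); pointwise. }
assert (G (gmin h k) <= inner G (gmin f g)).
{ apply inner_ge; [now apply gamble_min | now apply (lf_min HG) |].
  intro w; specialize (Hh w); specialize (Hk w); pointwise. }
lra.
Qed.

(** The argument passes through the inner extension because rounded gambles may lie outside
    [dom G]. *)
Lemma supermodular_comonotone_additive :
  supermodular (dom G) G -> comonotone_additive G.
Proof.
intros H f g Df Dg Dfg Hc; apply Rle_antisym; [|now apply (lf_superadd HG)].
rewrite <- !inner_extends by assumption.
apply (comonotone_subadd inner_lower_functional); auto.
- apply (supermodular_layer_additive inner_lower_functional), inner_supermodular, H.
- now apply (lf_gamble HG).
- now apply (lf_gamble HG).
Qed.

(** Taking $f \vee g$ as the top gamble, with [f] and [g] as the family, turns the case of two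
    members into supermodularity. Conversely, one member amounts to monotonicity, and two members to
    supermodularity of $f \wedge f_1$ and $f \wedge f_2$, whose maximum is at most [f]. *)
Lemma n_monotone_2_iff : n_monotone 2 G <-> supermodular (dom G) G.
Proof.
split.
- intros H f g Df Dg.
  assert (Hm := H 2%nat (gmax f g) (f :: g :: nil) ltac:(lia) eq_refl
                  (lf_max HG _ _ Df Dg) ltac:(auto)).
  cbn in Hm.
  replace (gmin (gmax f g) f) with f in Hm by gamble_ext.
  replace (gmin (gmax f g) g) with g in Hm by gamble_ext.
  lra.
- intros H p f fs Hp Hlen Df Hfs.
  destruct fs as [|f1 [|f2 [|]]]; cbn in Hlen; try lia.
  + inversion_clear Hfs.
    cbn.
    assert (G (gmin f f1) <= G f).
    { apply (lf_mono HG); auto; [now apply (lf_min HG) | pointwise]. }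
    lra.
  + inversion_clear Hfs as [|? ? D1 Hfs']; inversion_clear Hfs' as [|? ? D2 _].
    cbn.
    assert (D1' := lf_min HG _ _ Df D1); assert (D2' := lf_min HG _ _ Df D2).
    assert (Hs := H (gmin f f1) (gmin f f2) D1' D2').
    replace (gmin (gmin f f1) (gmin f f2)) with (gmin (gmin f f1) f2) in Hs by gamble_ext.
    assert (G (gmax (gmin f f1) (gmin f f2)) <= G f).
    { apply (lf_mono HG); auto; [now apply (lf_max HG) | pointwise]. }
    lra.
Qed.

Lemma comonotone_additive_iff_n_monotone_2 : comonotone_additive G <-> n_monotone 2 G.
Proof.
rewrite n_monotone_2_iff; split.
- intros H; apply (comonotone_supermodular HG).
  intros f g Df Dg; apply H; auto; now apply (lf_add HG).
- apply supermodular_comonotone_additive.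
Qed.

(** * The integral representation *)

Lemma gamble_indicator (A : Omega -> Prop) : gamble (indicator A).
Proof.
exists 1; intro w; unfold indicator.
destruct excluded_middle_informative; rewrite Rabs_right; lra.
Qed.

Lemma inner_event_monotone : monotone_set_function (inner_event G).
Proof.
split.
- unfold inner_event.
  replace (indicator (fun _ => False)) with (@gcst Omega 0).
  + rewrite inner_cst; ring.
  + apply functional_extensionality; intro w; unfold indicator, gcst.
    now destruct excluded_middle_informative.
- intros A B HAB; apply (lf_mono inner_lower_functional); try apply gamble_indicator.
  intro w; unfold indicator; specialize (HAB w).
  repeat destruct excluded_middle_informative; lra || tauto.
Qed.

Lemma inner_event_full : inner_event G (fun _ => True) = G (gcst 1).
Proof.
unfold inner_event.
replace (indicator (fun _ => True)) with (@gcst Omega 1).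
- rewrite inner_cst; ring.
- apply functional_extensionality; intro w; unfold indicator, gcst.
  now destruct excluded_middle_informative.
Qed.

Hypothesis G_scal : forall a f, 0 <= a -> dom G f -> dom G (gscal a f) /\ G (gscal a f) = a * G f.

Lemma layer_bounds f x y :
  layer_additive (dom G) G -> dom G f -> x <= y ->
  (y - x) * inner_event G (level_set f y)
    <= G (gmin f (gcst y)) - G (gmin f (gcst x))
    <= (y - x) * inner_event G (level_set f x).
Proof.
intros HL Df [Hxy| ->]; [|lra].
assert (Dy : dom G (gmin f (gcst y))) by (apply (lf_min HG); auto; apply (lf_cst HG)).
rewrite (HL (gmin f (gcst y)) x Dy).
replace (gmin (gmin f (gcst y)) (gcst x)) with (gmin f (gcst x)) by gamble_ext.
assert (Dl := excess_dom HG _ x Dy).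
set (l := excess (gmin f (gcst y)) x) in *.
replace (G (gmin f (gcst x)) + G l - G (gmin f (gcst x))) with (G l) by ring.
assert (Hinv : 0 < / (y - x)) by (apply Rinv_0_lt_compat; lra).
split.
- apply Rmult_le_reg_l with (/ (y - x)); auto.
  replace (/ (y - x) * ((y - x) * inner_event G (level_set f y)))
    with (inner_event G (level_set f y)) by (field; lra).
  (* Lower bound: each minorant [g] of the indicator of $\{f \ge y\}$, scaled by [y - x], lies below
     the layer [l]. *)
  apply inner_le; [apply gamble_indicator|]; intros g Dg Hg.
  apply Rmult_le_reg_l with (y - x); [lra|].
  replace ((y - x) * (/ (y - x) * G l)) with (G l) by (field; lra).
  destruct (G_scal (y - x) g ltac:(lra) Dg) as [Ds <-].
  apply (lf_mono HG); auto; intro w; specialize (Hg w); unfold gscal, indicator, level_set in *.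
  assert (Hg' : (y - x) * g w
      <= (y - x) * (if excluded_middle_informative (f w >= y) then 1 else 0))
    by (apply Rmult_le_compat_l; lra).
  eapply Rle_trans; [exact Hg'|]; unfold l.
  destruct excluded_middle_informative; clear Hg Hg'; pointwise.
- apply Rmult_le_reg_l with (/ (y - x)); auto.
  replace (/ (y - x) * ((y - x) * inner_event G (level_set f x)))
    with (inner_event G (level_set f x)) by (field; lra).
  (* Upper bound: the rescaled layer is itself an admissible minorant of the indicator of $\{f \ge
     x\}$. *)
  destruct (G_scal (/ (y - x)) l ltac:(lra) Dl) as [Ds <-].
  apply inner_ge; [apply gamble_indicator | auto |].
  intro w; unfold gscal, indicator, level_set.
  apply Rmult_le_reg_l with (y - x); [lra|].
  rewrite <- Rmult_assoc, Rinv_r, Rmult_1_l by lra; unfold l.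
  destruct excluded_middle_informative; pointwise.
Qed.

(** A point of [Omega] and the bound [M] exclude infinite extrema, which [real] would send to 0. *)
Lemma gamble_inf_sup (f : Omega -> R) : inhabited Omega -> gamble f ->
  ginf f <= gsup f /\ forall w, ginf f <= f w <= gsup f.
Proof.
intros [w0] [M HM].
assert (Hf : forall w, - M <= f w <= M) by (intro w; now apply Rabs_le_between).
assert (H : forall w, ginf f <= f w <= gsup f); [|split; auto; specialize (H w0); lra].
unfold ginf, gsup; set (S := fun y => _).
destruct (Lub_Rbar_correct S) as [U1 U2], (Glb_Rbar_correct S) as [L1 L2].
assert (HU : Rbar_le (Lub_Rbar S) M) by (apply U2; intros y [w ->]; apply Hf).
assert (HL : Rbar_le (- M) (Glb_Rbar S)) by (apply L2; intros y [w ->]; apply Hf).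
intro w.
assert (Hu := U1 (f w) (ex_intro _ w eq_refl)).
assert (Hl := L1 (f w) (ex_intro _ w eq_refl)).
destruct (Lub_Rbar S), (Glb_Rbar S); simpl in *; tauto || lra.
Qed.

Lemma layer_additive_is_RInt f : inhabited Omega -> layer_additive (dom G) G -> dom G f ->
  is_RInt (fun x => inner_event G (level_set f x)) (ginf f) (gsup f)
    (G f - G (gcst 1) * ginf f).
Proof.
intros HO HL Df.
destruct (gamble_inf_sup f HO (lf_gamble HG f Df)) as [His Hf].
replace (G f - G (gcst 1) * ginf f)
  with (G (gmin f (gcst (gsup f))) - G (gmin f (gcst (ginf f)))).
- apply (antitone_is_RInt _ (fun x => G (gmin f (gcst x)))); auto.
  + intros x y Hxy; apply inner_event_monotone; unfold level_set; intros; lra.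
  + intros x y Hxy; now apply layer_bounds.
- replace (gmin f (gcst (gsup f))) with f
    by (apply functional_extensionality; intro w; specialize (Hf w); pointwise).
  replace (gmin f (gcst (ginf f))) with (@gcst Omega (ginf f))
    by (apply functional_extensionality; intro w; specialize (Hf w); pointwise).
  rewrite (lf_val_cst HG (ginf f)); ring.
Qed.

End Inner.

(** * Exact functionals and their norm *)

Section Exact.

Context {Omega : Type}.
Variable G : functional Omega.
Hypothesis G_exact : exact_functional G.
Hypothesis G_lattice : linear_lattice (dom G).
Hypothesis G_constants : forall mu, dom G (gcst mu).

Lemma exact_scal a f : 0 <= a -> dom G f -> dom G (gscal a f) /\ G (gscal a f) = a * G f.
Proof.
destruct G_exact as (E & (_ & _ & Hscal & _) & HE), G_lattice as [(_ & _ & Ds) _].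
intros Ha Df; assert (Daf := Ds a f Df); split; auto.
rewrite <- (proj2 (HE _ Daf)), <- (proj2 (HE _ Df)).
apply Hscal; auto; now apply dom_gamble with G.
Qed.

Lemma exact_lower_functional : lower_functional (dom G) G.
Proof.
destruct G_exact as (E & (Edom & Emono & _ & Esup & Eshift) & HE).
destruct G_lattice as [(_ & Da & _) Dl].
assert (Gb : forall f, dom G f -> gamble f) by (intros f Df; now apply dom_gamble with G).
assert (HG : forall f, dom G f -> G f = E f)
  by (intros f Df; symmetry; now apply (proj2 (HE f Df))).
assert (Hshift : forall f mu, dom G f -> G (gadd f (gcst mu)) = G f + G (gcst mu)).
{ intros f mu Df; rewrite !HG by auto; auto. }
assert (Hpos : forall mu, 0 <= mu -> G (gcst mu) = mu * G (gcst 1)).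
{ intros mu Hmu; rewrite <- (proj2 (exact_scal mu (gcst 1) Hmu (G_constants 1))).
  f_equal; gamble_ext. }
(* Homogeneity covers only nonnegative constants; a negative one is reached by adding its opposite
   and using the shift rule. *)
assert (Hcst : forall mu, G (gcst mu) = mu * G (gcst 1)).
{ intros mu; destruct (Rle_lt_dec 0 mu) as [Hmu|Hmu]; auto.
  assert (H := Hshift (gcst mu) (- mu) (G_constants mu)).
  replace (gadd (gcst mu) (gcst (- mu))) with (@gcst Omega 0) in H by gamble_ext.
  rewrite (Hpos 0), (Hpos (- mu)) in H by lra; lra. }
constructor; auto.
- intros f g Df Dg; apply Dl; auto.
- intros f g Df Dg; apply Dl; auto.
- intros f g Df Dg Hfg; rewrite !HG by auto; apply Rge_le, Emono; auto.
- intros f g Df Dg; rewrite !HG by auto; apply Rge_le, Esup; auto.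
- intros f mu Df; rewrite Hshift, Hcst by auto; reflexivity.
Qed.

Lemma sum_dom (a : nat -> R) (fs : nat -> Omega -> R) n :
  (forall k, (1 <= k <= n)%nat -> 0 <= a k /\ dom G (fs k)) ->
  dom G (fun w => sum_n_m (fun k => a k * fs k w) 1 n) /\
  sum_n_m (fun k => a k * G (fs k)) 1 n <= G (fun w => sum_n_m (fun k => a k * fs k w) 1 n).
Proof.
assert (HG := exact_lower_functional).
induction n as [|n IH]; intro H.
- replace (fun w => sum_n_m (fun k => a k * fs k w) 1 0) with (@gcst Omega 0)
    by (apply functional_extensionality; intro w; now rewrite sum_n_m_zero by lia).
  rewrite sum_n_m_zero, (val_cst0 HG) by lia; split; auto.
  right; reflexivity.
- destruct IH as [Ds Hs]; [intros k Hk; apply H; lia|].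
  destruct (H (S n) ltac:(lia)) as [Ha Df].
  destruct (exact_scal _ _ Ha Df) as [Daf Haf].
  replace (fun w => sum_n_m (fun k => a k * fs k w) 1 (S n))
    with (gadd (fun w => sum_n_m (fun k => a k * fs k w) 1 n) (gscal (a (S n)) (fs (S n))))
    by (apply functional_extensionality; intro w; now rewrite sum_n_Sm by lia).
  split; [now apply (lf_add HG)|].
  rewrite sum_n_Sm by lia; unfold plus; simpl.
  assert (Hsup := lf_superadd HG _ _ Ds Daf); lra.
Qed.

(** Monotonicity and the shift rule bound [G f] below by the value of the sum plus
    [lam * G (gcst 1)]; superadditivity and homogeneity then split the sum. *)
Lemma norm_bound_cst1 : norm_bound G (G (gcst 1)).
Proof.
assert (HG := exact_lower_functional).
split; [apply (cst1_ge0 HG)|].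
intros n a lam f fs _ Hfs Df Hle.
destruct (sum_dom a fs n Hfs) as [Ds Hs].
apply Rle_ge.
eapply Rle_trans; [apply Rplus_le_compat_r, Hs|].
rewrite <- (lf_shift HG) by auto.
apply (lf_mono HG); auto; [apply (lf_add HG); auto|].
intro w; apply Rge_le, Hle.
Qed.

(* The lower bound comes from testing the defining inequality on [-1 >= 0 * 0 - 1]. *)
Lemma fnorm_eq : fnorm G = G (gcst 1).
Proof.
assert (HG := exact_lower_functional).
apply is_glb_Rbar_unique; split.
- intros c [_ Hc]; simpl.
  assert (H := Hc 1%nat (fun _ => 0) (-1) (gcst (-1)) (fun _ => gcst 0) ltac:(lia)
    ltac:(intros; split; [lra | auto]) (G_constants _)
    ltac:(intro w; rewrite sum_n_n; unfold gcst; lra)).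
  rewrite sum_n_n, (lf_val_cst HG (-1)) in H; lra.
- intros b Hb; apply Hb, norm_bound_cst1.
Qed.

End Exact.

Theorem theorem18 (Omega : Type) (Omega_nonempty : inhabited Omega)
    (G : functional Omega)
    (G_exact : exact_functional G)
    (G_lattice : linear_lattice (dom G))
    (G_constants : forall mu : R, dom G (gcst mu)) :
  (comonotone_additive G <-> n_monotone 2 G) /\
  (comonotone_additive G \/ n_monotone 2 G ->
     is_finite (fnorm G) /\
     monotone_set_function (inner_event G) /\
     forall f : Omega -> R, dom G f ->
       ex_RInt (fun x => inner_event G (level_set f x)) (ginf f) (gsup f) /\
       G f = choquet (inner_event G) f /\
       choquet (inner_event G) f =
         real (fnorm G) * ginf f
         + RInt (fun x => inner_event G (level_set f x)) (ginf f) (gsup f)).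
Proof.
assert (HG := exact_lower_functional G G_exact G_lattice G_constants).
assert (Hiff := comonotone_additive_iff_n_monotone_2 G HG).
split; [exact Hiff|]; intro H.
(* By the equivalence, either alternative yields supermodularity. *)
assert (HL : layer_additive (dom G) G).
{ apply (supermodular_layer_additive HG), (n_monotone_2_iff G HG); tauto. }
rewrite (fnorm_eq G G_exact G_lattice G_constants).
split; [reflexivity|].
split; [now apply inner_event_monotone|].
intros f Df.
assert (Hint := layer_additive_is_RInt G HG (exact_scal G G_exact G_lattice) f
                  Omega_nonempty HL Df).
unfold choquet; rewrite (inner_event_full G HG), (is_RInt_unique _ _ _ _ Hint).
repeat split; [now exists (G f - G (gcst 1) * ginf f)|].
ring.
Qed.
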